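(* Let $k_1\le k_2$ be non-negative integers. Let $\bar\varphi_{l_1,l_2,l_3}=\bar\varphi^{k_1,k_2}_{l_1,l_2,l_3}(z_1,z_2)$, $(l_1,l_2,l_3)\in\bar R_U^{k_1,k_2}$, and $\bar\psi_{l_1,l_2,l_3}=\bar\psi^{k_1,k_2}_{l_1,l_2,l_3}(z_1,z_2)$, $(l_1,l_2,l_3)\in R_V^{k_1,k_2}$, be formal power series in $z_1,z_2$ such that the following inequalities hold (with the conventions of the context). If $(l_1,l_2,l_3)\in R_U^{k_1,k_2}$: $\ \bar\varphi_{l_1,l_2,l_3}(z_1,z_2)\le\bar\varphi_{l_1,l_2-1,l_3}(z_1,z_2)+z_2^{l_2}\bar\psi_{l_3,k_2-l_2,l_1}(q^{-1}z_1,qz_2)$. If $(l_1,l_2,l_3)\in R_V^{k_1,k_2}$: $\ \bar\psi_{l_1,l_2,l_3}(z_1,z_2)\le\bar\psi_{l_1,l_2-1,l_3}(z_1,z_2)+z_2^{l_2}\bar\varphi_{l_3,k_2-l_2,l_1}(z_1,qz_2)$. If $(l_1,l_2,l_3)\in\bar R_U^{k_1,k_2}$ and either $l_1+l_2-l_3\ne k_2$ or $l_3=0$: $\ \bar\varphi_{l_1,l_2,l_3}(z_1,z_2)\le\bar\varphi_{l_1,l_2,l_3-1}(z_1,z_2)+(q^{-1}z_1z_2)^{l_3}\bar\psi_{l_1-l_3,l_2-l_3,k_1-l_3}(z_1,z_2)$. If $(l_1,l_2,l_3)\in R_V^{k_1,k_2}$: $\ \bar\psi_{l_1,l_2,l_3}(z_1,z_2)\le\bar\psi_{l_1-1,l_2,l_3}(z_1,z_2)+z_1^{l_1}\bar\varphi_{k_1-l_1,l_1+l_2,l_3-l_1}(qz_1,z_2)$.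 Assume that all coefficients of these power series (in $z_1,z_2$) are Laurent power series in $q$ with non-negative integer coefficients, and that $\bar\psi_{0,0,0}$ has no constant term (in $z_1,z_2$). Then all these formal power series are identically zero.
   Context: Regions (integer triples): $P_U^{k_1,k_2}=\{0\le l_1\le k_1,\ 0\le l_2\le k_2,\ 0\le l_3\le\min(l_1,l_2)\}$; $P_V^{k_1,k_2}=\{0\le l_1\le k_1,\ 0\le l_2\le k_2,\ l_1\le l_3\le\min(l_1+l_2,k_1)\}$; $R_U^{k_1,k_2}=\{k_1\le l_1+l_2-l_3\le k_2\}\cap P_U^{k_1,k_2}$; $\bar R_U^{k_1,k_2}=\{0\le l_1+l_2-l_3\le k_2\}\cap P_U^{k_1,k_2}$; $R_V^{k_1,k_2}=\{0\le l_1+l_2-l_3\le k_2-k_1\}\cap P_V^{k_1,k_2}$. A Laurent power series in $q$ has only finitely many negative powers. $f\le g$ means coefficientwise inequality for all monomials $z_1^{m_1}z_2^{m_2}q^d$. Conventions: a series with a negative index is zero; if $l_3>\min(l_1,l_2)$ then $\bar\varphi_{l_1,l_2,l_3}:=\bar\varphi_{l_1,l_2,\min(l_1,l_2)}$; if $l_3>l_1+l_2$ then $\bar\psi_{l_1,l_2,l_3}:=\bar\psi_{l_1,l_2,l_1+l_2}$. *)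

(* Defs.v *)
From mathcomp Require Import all_boot all_order all_algebra.

Set Implicit Arguments.
Unset Strict Implicit.
Unset Printing Implicit Defensive.

Import Order.TTheory GRing.Theory Num.Theory.
Local Open Scope ring_scope.

Section Regions.
Variables k1 k2 : int.
Implicit Type l : int.

Definition P_U l1 l2 l3 : bool :=
  [&& 0 <= l1 <= k1, 0 <= l2 <= k2 & 0 <= l3 <= Num.min l1 l2].

Definition P_V l1 l2 l3 : bool :=
  [&& 0 <= l1 <= k1, 0 <= l2 <= k2 & l1 <= l3 <= Num.min (l1 + l2) k1].

Definition R_U l1 l2 l3 : bool :=
  (k1 <= l1 + l2 - l3 <= k2) && P_U l1 l2 l3.

Definition Rbar_U l1 l2 l3 : bool :=
  (0 <= l1 + l2 - l3 <= k2) && P_U l1 l2 l3.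

Definition R_V l1 l2 l3 : bool :=
  (0 <= l1 + l2 - l3 <= k2 - k1) && P_V l1 l2 l3.

End Regions.

(** [f m1 m2 d] is the coefficient of [z1^m1 z2^m2 q^d]; that only finitely
    many negative powers of [q] occur in each [f m1 m2] is imposed separately,
    by [laurent]. *)
Definition series := nat -> nat -> int -> int.

Definition laurent (c : int -> int) : Prop :=
  exists N : int, forall d : int, d < N -> c d = 0.

Definition nonneg_laurent_coefs (f : series) : Prop :=
  forall m1 m2 : nat, laurent (f m1 m2) /\ forall d : int, 0 <= f m1 m2 d.

Definition szero : series := fun _ _ _ => 0.

Definition sadd (f g : series) : series :=
  fun m1 m2 d => f m1 m2 d + g m1 m2 d.

Definition sle (f g : series) : Prop :=
  forall (m1 m2 : nat) (d : int), f m1 m2 d <= g m1 m2 d.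

(** [z1^a z2^b q^c * f] *)
Definition monomial_mul (a b : nat) (c : int) (f : series) : series :=
  fun m1 m2 d =>
    if (a <= m1)%N && (b <= m2)%N then f (m1 - a)%N (m2 - b)%N (d - c) else 0.

(** [f (q^a z1, q^b z2)] *)
Definition qsubst (a b : int) (f : series) : series :=
  fun m1 m2 d => f m1 m2 (d - (a * m1%:Z + b * m2%:Z)).

(** A family is a total function of the integer triple, but only its values on
    the relevant region are meaningful. [conv_phi] and [conv_psi] apply the
    conventions for indices that leave the region: a negative index gives the
    zero series, and a too large third index is truncated. *)
Definition series_family := int -> int -> int -> series.

Definition conv_phi (phi : series_family) : series_family := fun l1 l2 l3 =>
  if [|| l1 < 0, l2 < 0 | l3 < 0] then szero
  else phi l1 l2 (Num.min l3 (Num.min l1 l2)).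

Definition conv_psi (psi : series_family) : series_family := fun l1 l2 l3 =>
  if [|| l1 < 0, l2 < 0 | l3 < 0] then szero
  else psi l1 l2 (Num.min l3 (l1 + l2)).

(* Main.v *)
Require Import Defs.
From mathcomp Require Import all_boot all_order all_algebra.
From mathcomp Require Import zify.

(** The coefficients at a fixed monomial [z1^m1 z2^m2] are killed by induction
    on [m1 + m2].  Once all coefficients of smaller total degree vanish, a
    summand carrying a factor [z1^a z2^b] with [a + b > 0] contributes nothing
    in degree [(m1, m2)], so each inequality reduces either to a step that
    lowers an index with the power of [q] unchanged, or, when the exponent of
    the monomial is zero, to a step exchanging a [phi] and a [psi] at the cost
    of a power of [q] ([degree_system]).

    Lowering [l1] takes any [psi] to a [psi_(0,l2,l3)], which is exchanged for
    [phi_(k1,l2,l3)] with the factor [q^m1]; lowering [l2] then takes this to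
    [phi_(k1,0,0)].  So every [psi] is bounded by [q^m1 phi_(k1,0,0)]
    ([v_le_corner]).  The corner [phi_(k1,0,0)] is in turn bounded by two
    different series: by [psi_(k1,0,k1)], and by [q^(m2 - m1) psi_(0,k2,k1)].
    Applying the bound to [psi_(k1,0,k1)] and to [psi_(0,k2,k1)] themselves
    gives two loops [f <= q^m1 f] and [f <= q^m2 f], and a Laurent series with
    non-negative coefficients that is dominated by a positive power of [q]
    times itself is zero ([laurent_loop_eq0]).  Hence every [psi] vanishes in
    degree [(m1, m2)] as soon as [m1] or [m2] is positive; in degree [(0, 0)]
    lowering [l1] and then [l2] reaches [psi_(0,0,0)], whose constant term is
    zero by assumption.  Finally every [phi] can be lowered until it is
    exchanged for a [psi]. *)

Set Implicit Arguments.
Unset Strict Implicit.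
Unset Printing Implicit Defensive.

Import Order.TTheory GRing.Theory Num.Theory.
Local Open Scope ring_scope.

Ltac region := unfold R_U, Rbar_U, R_V, P_U, P_V in *; lia.

(** Iterating the bound moves every coefficient below the order of the
    series. *)
Lemma laurent_loop_eq0 (c : int -> int) (a : int) :
  laurent c -> (forall d, 0 <= c d) -> 0 < a -> (forall d, c d <= c (d - a)) ->
  forall d, c d = 0.
Proof.
move=> [N cN] c_ge0 a_gt0 c_loop d.
have c_iter n : c d <= c (d - n%:Z * a).
  elim: n => [|n IHn]; first by rewrite mul0r subr0.
  apply: le_trans IHn (le_trans (c_loop _) _).
  by rewrite -addrA -opprD intS mulrDl mul1r addrC [a + _]addrC addrC.
pose n := `|(d - N)%R|.+1.
have n_le : n%:Z <= n%:Z * a by rewrite ler_peMr.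
have := c_iter n; rewrite (cN (d - _)); last first.
  by move: (_ * a) n_le => b; rewrite /n; lia.
by move=> cd_le0; apply/eqP; rewrite eq_le cd_le0 c_ge0.
Qed.

(** What the inequalities say in degree [(m1, m2)] when all coefficients of
    smaller total degree vanish; [u] and [v] stand for the coefficients of
    [phi] and [psi], as functions of the index triple and the power of [q].
    The minima implement the truncation of the third index. *)
Record degree_system (k1 k2 : int) (m1 m2 : nat)
    (u v : int -> int -> int -> int -> int) : Prop := DegreeSystem {
  lower_u2 : forall l1 l2 l3 d, R_U k1 k2 l1 l2 l3 -> 0 < l2 ->
    u l1 l2 l3 d <= u l1 (l2 - 1) (Num.min l3 (Num.min l1 (l2 - 1))) d;
  lower_u3 : forall l1 l2 l3 d, Rbar_U k1 k2 l1 l2 l3 -> 0 < l3 ->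
    l1 + l2 - l3 <> k2 -> u l1 l2 l3 d <= u l1 l2 (l3 - 1) d;
  lower_v1 : forall l1 l2 l3 d, R_V k1 k2 l1 l2 l3 -> 0 < l1 ->
    v l1 l2 l3 d <= v (l1 - 1) l2 (Num.min l3 (l1 - 1 + l2)) d;
  lower_v2 : forall l1 l2 l3 d, R_V k1 k2 l1 l2 l3 -> 0 < l2 ->
    v l1 l2 l3 d <= v l1 (l2 - 1) (Num.min l3 (l1 + (l2 - 1))) d;
  corner_u_v : forall d, u k1 0 0 d <= v 0 k2 k1 (d - (m2%:Z - m1%:Z));
  u0_v : forall l1 l2 d, Rbar_U k1 k2 l1 l2 0 ->
    u l1 l2 0 d <= v l1 l2 (Num.min k1 (l1 + l2)) d;
  v0_u : forall l2 l3 d, R_V k1 k2 0 l2 l3 ->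
    v 0 l2 l3 d <= u k1 l2 l3 (d - m1%:Z)
}.

(** * Descent inside a fixed degree *)

Section Descent.
Variables (k1 k2 : int) (m1 m2 : nat) (u v : int -> int -> int -> int -> int).
Hypotheses (hk1 : 0 <= k1) (hk12 : k1 <= k2).
Hypothesis uvS : degree_system k1 k2 m1 m2 u v.

Lemma v_le_v0 l1 l2 l3 d : R_V k1 k2 l1 l2 l3 ->
  exists2 l3', R_V k1 k2 0 l2 l3' & v l1 l2 l3 d <= v 0 l2 l3' d.
Proof.
have [n] := ubnP `|l1|%N; elim: n => // n IHn in l1 l3 * => ltn RVl.
have [l1_eq0|l1_neq0] := eqVneq l1 0; first by exists l3; rewrite -?l1_eq0.
have l1_gt0 : 0 < l1 by clear -RVl l1_neq0; region.
have [||l3' RVl' le_v'] := IHn (l1 - 1) (Num.min l3 (l1 - 1 + l2)).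
- by clear -ltn l1_gt0; lia.
- by clear -RVl l1_gt0; region.
by exists l3' => //; apply: le_trans le_v'; apply: (lower_v1 uvS).
Qed.

(** With [l1 = k1] every step stays in the region where [l2] can be lowered,
    since [k1 + l2 - l3 >= k1]. *)
Lemma u_le_corner l2 l3 d : Rbar_U k1 k2 k1 l2 l3 -> u k1 l2 l3 d <= u k1 0 0 d.
Proof.
have [n] := ubnP `|l2|%N; elim: n => // n IHn in l2 l3 * => ltn RUl.
have [l2_eq0|l2_neq0] := eqVneq l2 0.
  by have -> : l3 = 0 by [clear -RUl l2_eq0; region]; rewrite l2_eq0.
have l2_gt0 : 0 < l2 by clear -RUl l2_neq0; region.
apply: le_trans (lower_u2 uvS _ _ l2_gt0) _; first by clear -RUl; region.
by apply: IHn; [clear -ltn l2_gt0; lia | clear -RUl l2_gt0; region].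
Qed.

Lemma v0_le_v00 l2 l3 d : R_V k1 k2 0 l2 l3 -> v 0 l2 l3 d <= v 0 0 0 d.
Proof.
have [n] := ubnP `|l2|%N; elim: n => // n IHn in l2 l3 * => ltn RVl.
have [l2_eq0|l2_neq0] := eqVneq l2 0.
  by have -> : l3 = 0 by [clear -RVl l2_eq0; region]; rewrite l2_eq0.
have l2_gt0 : 0 < l2 by clear -RVl l2_neq0; region.
apply: le_trans (lower_v2 uvS _ RVl l2_gt0) _.
by apply: IHn; [clear -ltn l2_gt0; lia | clear -RVl l2_gt0; region].
Qed.

Lemma v_le_corner l1 l2 l3 d : R_V k1 k2 l1 l2 l3 ->
  v l1 l2 l3 d <= u k1 0 0 (d - m1%:Z).
Proof.
move=> /(v_le_v0 d)[l3' RVl' le_v0].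
apply: le_trans le_v0 (le_trans (v0_u uvS _ RVl') (u_le_corner _ _)).
by clear -hk1 hk12 RVl'; region.
Qed.

Hypothesis v_laurent : forall l1 l2 l3, R_V k1 k2 l1 l2 l3 ->
  laurent (v l1 l2 l3) /\ forall d, 0 <= v l1 l2 l3 d.
Hypothesis u_ge0 : forall l1 l2 l3 d, Rbar_U k1 k2 l1 l2 l3 ->
  0 <= u l1 l2 l3 d.

(** The exchange of the corner for [v k1 0 k1] closes a loop of gain [q^m1], the
    one for [v 0 k2 k1] a loop of gain [q^m2]. *)
Lemma corner_eq0 d : (0 < m1 + m2)%N -> u k1 0 0 d = 0.
Proof.
move=> m_gt0.
have corner_RU : Rbar_U k1 k2 k1 0 0 by clear -hk1 hk12; region.
have RV10 : R_V k1 k2 k1 0 k1 by clear -hk1 hk12; region.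
have RV02 : R_V k1 k2 0 k2 k1 by clear -hk1 hk12; region.
have corner_le10 e : u k1 0 0 e <= v k1 0 k1 e.
  have := u0_v uvS e corner_RU.
  by rewrite addr0 minxx.
apply/eqP; rewrite eq_le u_ge0 // andbT.
have [m1_eq0|m1_gt0] := posnP m1; last first.
  have [laurent10 v10_ge0] := v_laurent RV10.
  apply: le_trans (corner_le10 d) _.
  rewrite (laurent_loop_eq0 (a := m1%:Z) laurent10 v10_ge0) // => e.
  exact: le_trans (v_le_corner _ RV10) (corner_le10 _).
have [laurent02 v02_ge0] := v_laurent RV02.
apply: le_trans (corner_u_v uvS d) _.
rewrite (laurent_loop_eq0 (a := m2%:Z) laurent02 v02_ge0) //.
  by move: m_gt0; rewrite m1_eq0.
move=> e; apply: le_trans (v_le_corner _ RV02) _.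
by apply: le_trans (corner_u_v uvS _) _; rewrite m1_eq0 !subr0.
Qed.

Lemma v_eq0 l1 l2 l3 d : (m1 + m2 = 0 -> forall e, v 0 0 0 e = 0)%N ->
  R_V k1 k2 l1 l2 l3 -> v l1 l2 l3 d = 0.
Proof.
move=> v00_eq0 RVl; apply/eqP; rewrite eq_le (v_laurent RVl).2 andbT.
have [m_eq0|m_gt0] := posnP (m1 + m2); last first.
  by apply: le_trans (v_le_corner _ RVl) _; rewrite corner_eq0.
have [l3' RVl' le_v0] := v_le_v0 d RVl.
apply: le_trans le_v0 (le_trans (v0_le_v00 _ RVl') _).
by rewrite v00_eq0.
Qed.

(** When [l1 + l2 - l3 >= k1] lower [l2]; otherwise [l1 + l2 - l3 < k1 <= k2],
    so that lowering [l3] is allowed. *)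
Lemma u_eq0 l1 l2 l3 d :
  (forall l1 l2 l3 d, R_V k1 k2 l1 l2 l3 -> v l1 l2 l3 d = 0) ->
  Rbar_U k1 k2 l1 l2 l3 -> u l1 l2 l3 d = 0.
Proof.
move=> v0 RUl; apply/eqP; rewrite eq_le u_ge0 // andbT.
have [n] := ubnP (`|l2| + `|l3|)%N; elim: n => // n IHn in l2 l3 RUl * => ltn.
have [k1_le|k1_gt] := leP k1 (l1 + l2 - l3).
  have [l2_eq0|l2_neq0] := eqVneq l2 0.
    have [-> -> ->] : [/\ l1 = k1, l2 = 0 & l3 = 0].
      by clear -RUl k1_le l2_eq0; split; region.
    apply: le_trans (corner_u_v uvS d) _.
    by rewrite v0 //; clear -hk1 hk12; region.
  have l2_gt0 : 0 < l2 by clear -RUl l2_neq0; region.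
  apply: le_trans (lower_u2 uvS _ _ l2_gt0) _; first by clear -RUl k1_le; region.
  by apply: IHn; clear -RUl ltn l2_gt0; region.
have [l3_eq0|l3_neq0] := eqVneq l3 0.
  rewrite l3_eq0 in RUl k1_gt *.
  apply: le_trans (u0_v uvS d RUl) _.
  by rewrite v0 //; clear -RUl k1_gt hk12; region.
have l3_gt0 : 0 < l3 by clear -RUl l3_neq0; region.
apply: le_trans (lower_u3 uvS _ RUl l3_gt0 _) _; first by clear -k1_gt hk12; lia.
by apply: IHn; clear -RUl ltn l3_gt0 k1_gt hk12; region.
Qed.

End Descent.

(** * Extracting the inequalities of a fixed degree *)

Definition vanishes_below (n : nat) (f : series) : Prop :=
  forall n1 n2 d, (n1 + n2 < n)%N -> f n1 n2 d = 0.

Lemma qsubst_below a b n f :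
  vanishes_below n f -> vanishes_below n (qsubst a b f).
Proof. by move=> f0 n1 n2 d lt_n; apply: f0. Qed.

Lemma sle_drop_shifted (f g h : series) a b c m1 m2 d :
  sle f (sadd g (monomial_mul a b c h)) -> (0 < a + b)%N ->
  vanishes_below (m1 + m2) h -> f m1 m2 d <= g m1 m2 d.
Proof.
move=> /(_ m1 m2 d) le_f ab_gt0 h0; apply: le_trans le_f _.
rewrite /sadd /monomial_mul; case: ifP => [/andP[le_a le_b]|_].
  by rewrite h0 ?addr0 //; lia.
by rewrite addr0.
Qed.

Lemma sle_keep_unshifted (f h : series) m1 m2 d :
  sle f (sadd szero (monomial_mul 0 0 0 h)) -> f m1 m2 d <= h m1 m2 d.
Proof.
by move=> /(_ m1 m2 d); rewrite /sadd /monomial_mul /= !subn0 subr0 add0r.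
Qed.

Lemma conv_phiE phi l1 l2 l3 : 0 <= l1 -> 0 <= l2 -> 0 <= l3 ->
  conv_phi phi l1 l2 l3 = phi l1 l2 (Num.min l3 (Num.min l1 l2)).
Proof. by move=> *; rewrite /conv_phi !ltNge; case: ifP => //; lia. Qed.

Lemma conv_psiE psi l1 l2 l3 : 0 <= l1 -> 0 <= l2 -> 0 <= l3 ->
  conv_psi psi l1 l2 l3 = psi l1 l2 (Num.min l3 (l1 + l2)).
Proof. by move=> *; rewrite /conv_psi !ltNge; case: ifP => //; lia. Qed.

Lemma conv_phi_neg phi l1 l2 l3 : [|| l1 < 0, l2 < 0 | l3 < 0] ->
  conv_phi phi l1 l2 l3 = szero.
Proof. by rewrite /conv_phi => ->. Qed.

Lemma conv_psi_neg psi l1 l2 l3 : [|| l1 < 0, l2 < 0 | l3 < 0] ->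
  conv_psi psi l1 l2 l3 = szero.
Proof. by rewrite /conv_psi => ->. Qed.

Lemma degree_systemP (k1 k2 : int) (phi psi : series_family)
  (hk1 : 0 <= k1) (hk12 : k1 <= k2)
  (h1 : forall l1 l2 l3 : int, R_U k1 k2 l1 l2 l3 ->
    sle (phi l1 l2 l3)
        (sadd (conv_phi phi l1 (l2 - 1) l3)
              (monomial_mul 0 `|l2|%N 0
                 (qsubst (-1) 1 (conv_psi psi l3 (k2 - l2) l1)))))
  (h2 : forall l1 l2 l3 : int, R_V k1 k2 l1 l2 l3 ->
    sle (psi l1 l2 l3)
        (sadd (conv_psi psi l1 (l2 - 1) l3)
              (monomial_mul 0 `|l2|%N 0
                 (qsubst 0 1 (conv_phi phi l3 (k2 - l2) l1)))))
  (h3 : forall l1 l2 l3 : int, Rbar_U k1 k2 l1 l2 l3 ->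
    l1 + l2 - l3 <> k2 \/ l3 = 0 ->
    sle (phi l1 l2 l3)
        (sadd (conv_phi phi l1 l2 (l3 - 1))
              (monomial_mul `|l3|%N `|l3|%N (- l3)
                 (conv_psi psi (l1 - l3) (l2 - l3) (k1 - l3)))))
  (h4 : forall l1 l2 l3 : int, R_V k1 k2 l1 l2 l3 ->
    sle (psi l1 l2 l3)
        (sadd (conv_psi psi (l1 - 1) l2 l3)
              (monomial_mul `|l1|%N 0 0
                 (qsubst 1 0 (conv_phi phi (k1 - l1) (l1 + l2) (l3 - l1)))))) (m1 m2 : nat) :
  (forall l1 l2 l3, Rbar_U k1 k2 l1 l2 l3 ->
     vanishes_below (m1 + m2) (phi l1 l2 l3)) ->
  (forall l1 l2 l3, R_V k1 k2 l1 l2 l3 ->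
     vanishes_below (m1 + m2) (psi l1 l2 l3)) ->
  degree_system k1 k2 m1 m2
    (fun l1 l2 l3 => phi l1 l2 l3 m1 m2) (fun l1 l2 l3 => psi l1 l2 l3 m1 m2).
Proof.
move=> phi0 psi0; split.
- move=> l1 l2 l3 d RUl l2_gt0.
  have := sle_drop_shifted (m1 := m1) (m2 := m2) d (h1 _ _ _ RUl).
  rewrite conv_phiE; [|by clear -RUl l2_gt0; region..].
  apply; first by clear -l2_gt0; lia.
  apply: qsubst_below; rewrite conv_psiE; [|by clear -RUl; region..].
  by apply: psi0; clear -RUl; region.
- move=> l1 l2 l3 d RUl l3_gt0 sum_neq.
  have := sle_drop_shifted (m1 := m1) (m2 := m2) d (h3 _ _ _ RUl (or_introl sum_neq)).
  rewrite conv_phiE; [|by clear -RUl l3_gt0; region..].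
  rewrite (_ : Num.min _ _ = l3 - 1); last by clear -RUl; region.
  apply; first by clear -l3_gt0; lia.
  rewrite conv_psiE; [|by clear -RUl; region..].
  by apply: psi0; clear -RUl hk12; region.
- move=> l1 l2 l3 d RVl l1_gt0.
  have := sle_drop_shifted (m1 := m1) (m2 := m2) d (h4 _ _ _ RVl).
  rewrite conv_psiE; [|by clear -RVl l1_gt0; region..].
  apply; first by clear -l1_gt0; lia.
  apply: qsubst_below; rewrite conv_phiE; [|by clear -RVl; region..].
  by apply: phi0; clear -RVl hk1 hk12; region.
- move=> l1 l2 l3 d RVl l2_gt0.
  have := sle_drop_shifted (m1 := m1) (m2 := m2) d (h2 _ _ _ RVl).
  rewrite conv_psiE; [|by clear -RVl l2_gt0; region..].
  apply; first by clear -l2_gt0; lia.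
  apply: qsubst_below; rewrite conv_phiE; [|by clear -RVl; region..].
  by apply: phi0; clear -RVl hk1 hk12; region.
- move=> d.
  have corner_RU : R_U k1 k2 k1 0 0 by clear -hk1 hk12; region.
  have := h1 _ _ _ corner_RU; rewrite conv_phi_neg ?orbT //.
  move/(sle_keep_unshifted m1 m2 d) => le_u.
  apply: le_trans le_u _.
  rewrite /qsubst conv_psiE; [|by clear -hk1 hk12; lia..].
  rewrite (_ : Num.min _ _ = k1); last by clear -hk12; lia.
  by rewrite subr0 mulN1r mul1r [- _ + _]addrC.
- move=> l1 l2 d RUl.
  have := h3 _ _ _ RUl (or_intror erefl); rewrite conv_phi_neg ?orbT // !subr0 oppr0.
  move/(sle_keep_unshifted m1 m2 d).
  by rewrite conv_psiE; [|by clear -RUl; region..].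
- move=> l2 l3 d RVl.
  have := h4 _ _ _ RVl; rewrite conv_psi_neg //.
  move/(sle_keep_unshifted m1 m2 d).
  rewrite /qsubst !subr0 add0r conv_phiE; [|by clear -RVl hk1; region..].
  rewrite (_ : Num.min _ _ = l3); last by clear -RVl; region.
  by rewrite mul1r.
Qed.

Theorem corollary5p2 (k1 k2 : int) (phi psi : series_family)
  (hk1 : 0 <= k1) (hk12 : k1 <= k2)
  (h1 : forall l1 l2 l3 : int, R_U k1 k2 l1 l2 l3 ->
    sle (phi l1 l2 l3)
        (sadd (conv_phi phi l1 (l2 - 1) l3)
              (monomial_mul 0 `|l2|%N 0
                 (qsubst (-1) 1 (conv_psi psi l3 (k2 - l2) l1)))))
  (h2 : forall l1 l2 l3 : int, R_V k1 k2 l1 l2 l3 ->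
    sle (psi l1 l2 l3)
        (sadd (conv_psi psi l1 (l2 - 1) l3)
              (monomial_mul 0 `|l2|%N 0
                 (qsubst 0 1 (conv_phi phi l3 (k2 - l2) l1)))))
  (h3 : forall l1 l2 l3 : int, Rbar_U k1 k2 l1 l2 l3 ->
    l1 + l2 - l3 <> k2 \/ l3 = 0 ->
    sle (phi l1 l2 l3)
        (sadd (conv_phi phi l1 l2 (l3 - 1))
              (monomial_mul `|l3|%N `|l3|%N (- l3)
                 (conv_psi psi (l1 - l3) (l2 - l3) (k1 - l3)))))
  (h4 : forall l1 l2 l3 : int, R_V k1 k2 l1 l2 l3 ->
    sle (psi l1 l2 l3)
        (sadd (conv_psi psi (l1 - 1) l2 l3)
              (monomial_mul `|l1|%N 0 0
                 (qsubst 1 0 (conv_phi phi (k1 - l1) (l1 + l2) (l3 - l1))))))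
  (hphi : forall l1 l2 l3 : int, Rbar_U k1 k2 l1 l2 l3 ->
    nonneg_laurent_coefs (phi l1 l2 l3))
  (hpsi : forall l1 l2 l3 : int, R_V k1 k2 l1 l2 l3 ->
    nonneg_laurent_coefs (psi l1 l2 l3))
  (hpsi0 : forall d : int, psi 0 0 0 0%N 0%N d = 0) :
  (forall l1 l2 l3 : int, Rbar_U k1 k2 l1 l2 l3 ->
     forall (m1 m2 : nat) (d : int), phi l1 l2 l3 m1 m2 d = 0) /\
  (forall l1 l2 l3 : int, R_V k1 k2 l1 l2 l3 ->
     forall (m1 m2 : nat) (d : int), psi l1 l2 l3 m1 m2 d = 0).
Proof.
suff vanish n : (forall l1 l2 l3, Rbar_U k1 k2 l1 l2 l3 ->
      vanishes_below n (phi l1 l2 l3)) /\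
    (forall l1 l2 l3, R_V k1 k2 l1 l2 l3 -> vanishes_below n (psi l1 l2 l3)).
  split=> l1 l2 l3 Rl m1 m2 d.
    exact: (vanish (m1 + m2).+1).1 (ltnSn _).
  exact: (vanish (m1 + m2).+1).2 (ltnSn _).
elim: n => [|n [phi0 psi0]]; first by split.
have degree_eq0 m1 m2 : (m1 + m2 < n.+1)%N ->
    (forall l1 l2 l3 d, Rbar_U k1 k2 l1 l2 l3 -> phi l1 l2 l3 m1 m2 d = 0) /\
    (forall l1 l2 l3 d, R_V k1 k2 l1 l2 l3 -> psi l1 l2 l3 m1 m2 d = 0).
  move=> le_n.
  have phi_below l1 l2 l3 : Rbar_U k1 k2 l1 l2 l3 ->
      vanishes_below (m1 + m2) (phi l1 l2 l3).
    by move=> Rl n1 n2 d lt_m; apply: phi0 => //; apply: leq_trans lt_m _.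
  have psi_below l1 l2 l3 : R_V k1 k2 l1 l2 l3 ->
      vanishes_below (m1 + m2) (psi l1 l2 l3).
    by move=> Rl n1 n2 d lt_m; apply: psi0 => //; apply: leq_trans lt_m _.
  have system := degree_systemP hk1 hk12 h1 h2 h3 h4 phi_below psi_below.
  have psi_laurent l1 l2 l3 (Rl : R_V k1 k2 l1 l2 l3) := hpsi _ _ _ Rl m1 m2.
  have phi_ge0 l1 l2 l3 d (Rl : Rbar_U k1 k2 l1 l2 l3) := (hphi _ _ _ Rl m1 m2).2 d.
  have psi_eq0 l1 l2 l3 d : R_V k1 k2 l1 l2 l3 -> psi l1 l2 l3 m1 m2 d = 0.
    apply: (v_eq0 hk1 hk12 system psi_laurent phi_ge0).
    by move=> /eqP; rewrite addn_eq0 => /andP[/eqP-> /eqP->].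
  split=> // l1 l2 l3 d.
  exact: (u_eq0 hk1 hk12 system phi_ge0 d psi_eq0).
split=> l1 l2 l3 Rl n1 n2 d lt_n.
  exact: (degree_eq0 _ _ lt_n).1.
exact: (degree_eq0 _ _ lt_n).2.
Qed.
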